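(* Let $\epsilon>0$, $\delta>0$ and $k>0$ be constants, and let $C>0$ be a constant. For each $n\ge 1$ let $m=m(n)$ be an integer with $m\geq (2+\delta)n$, and let $A=A^{(n)}$ be an $\epsilon$-balanced random $n\times m$ integer matrix whose entries satisfy $|A_{ij}|\le C\,2^{n^{k}}$ almost surely. Then there is a constant $c>0$ (depending only on $\epsilon,\delta,k,C$) such that \[\mathbb{P}\big(A:\mathbb{Z}^{m}\to\mathbb{Z}^{n}\text{ is surjective}\big)=1-O(e^{-cn})\quad\text{as } n\to\infty.\]
   Context: A random variable $y$ taking values in $\mathbb{Z}$ is called $\epsilon$-balanced if for every prime $p$ and every residue $r\in\mathbb{Z}/p\mathbb{Z}$ we have $\mathbb{P}(y\equiv r \pmod p)\le 1-\epsilon$. (More generally, a random variable in a ring $T$ is $\epsilon$-balanced if for every maximal ideal $\mathfrak p$ of $T$ and every $r\in T/\mathfrak p$, $\mathbb{P}(y\equiv r\pmod{\mathfrak p})\le 1-\epsilon$; over a field this means $\mathbb{P}(y=r)\le 1-\epsilon$ for every $r$.) A random matrix is $\epsilon$-balanced if its entries are independent and each entry is $\epsilon$-balanced. An integer $n\times m$ matrix is viewed as a group homomorphism $\mathbb{Z}^m\to\mathbb{Z}^n$. *)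

(* Defs.v *)
From mathcomp Require Import all_boot all_order all_algebra.
From Stdlib Require Import Reals ClassicalEpsilon.
Set Implicit Arguments. Unset Strict Implicit. Unset Printing Implicit Defensive.

Section IntDefs.
Local Open Scope ring_scope.
Definition box_val (B : nat) (t : 'I_(2 * B + 1)) : int := Posz t - Posz B.
Definition int_dvd (q : nat) (z r : int) : bool := (z - r) \in dvdz (Posz q).
Definition mx_surjective (n m : nat) (A : 'M[int]_(n, m)) : Prop :=
  forall b : 'cV[int]_n, exists x : 'cV[int]_m, A *m x = b.
End IntDefs.
Local Open Scope R_scope.

Definition entry_bound (C k : R) (n : nat) : R :=
  (C * Rpower 2 (Rpower (INR n) k))%R.

(* An integer box [-B, B] containing every possible value of an entry. *)
Definition box_radius (C k : R) (n : nat) : nat :=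
  Z.to_nat (up (entry_bound C k n)).

Definition is_distribution (bound : R) (B : nat) (p : int -> R) : Prop :=
  (forall z, (0 <= p z)%R) /\
  (forall z : int, p z <> 0%R -> (IZR (Z.of_nat `|z|%N) <= bound)%R) /\
  (\big[Rplus/R0]_(t : 'I_(2 * B + 1)) p (box_val t) = 1%R).

Definition prob_congr (B : nat) (p : int -> R) (q : nat) (r : int) : R :=
  \big[Rplus/R0]_(t : 'I_(2 * B + 1))
     (if int_dvd q (box_val t) r then p (box_val t) else R0).

Definition eps_balanced (eps : R) (B : nat) (p : int -> R) : Prop :=
  forall (q : nat) (r : int), prime q -> (prob_congr B p q r <= 1 - eps)%R.

Definition box_mx (B n m : nat) (M : 'M['I_(2 * B + 1)]_(n, m)) : 'M[int]_(n, m) :=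
  \matrix_(i, j) box_val (M i j).

Definition prob_mx (B n m : nat) (p : 'I_n -> 'I_m -> int -> R)
  (E : 'M[int]_(n, m) -> Prop) : R :=
  \big[Rplus/R0]_(M : 'M['I_(2 * B + 1)]_(n, m))
     (if excluded_middle_informative (E (box_mx M)) then
        \big[Rmult/R1]_(i : 'I_n) \big[Rmult/R1]_(j : 'I_m) p i j (box_val (M i j))
      else R0).

(* Main.v *)
Require Import Defs.
From Stdlib Require Import Reals ZArith ClassicalEpsilon Psatz.
From mathcomp Require Import all_boot all_order all_algebra.
From mathcomp Require Import perm zify Rstruct.
Set Implicit Arguments. Unset Strict Implicit. Unset Printing Implicit Defensive.
Import Order.TTheory GRing.Theory Num.Theory.

(* By Odlyzko's argument an eps-balanced column falls in a given subspace of codimension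
   d of F_p^n with probability at most (1 - eps)^d, whatever p.  Exposing columns one by
   one, (1 + delta/2) n of them fail to span F_p^n with probability O(e^(-cn)), uniformly
   in p.  Split the columns into two halves.  If the first half spans F_2^n, some n x n
   minor of it is a nonzero integer, at most n! B^n with B the bound on the entries, so
   only polynomially many primes divide it.  If the second half spans F_p^n for each of
   these primes, the columns generate Z^n; a union bound concludes. *)

(** * Expectation over independent draws *)

Local Open Scope ring_scope.

(** The recursion exposes one independent draw at a time, the form used by the inductions on entries
    and on columns. *)
Fixpoint Ex (R : realFieldType) (J : Type) (V : finType) (D : J -> V -> R)
    (js : seq J) (f : seq V -> R) : R :=
  if js is j :: js' then \sum_v D j v * Ex D js' (fun s => f (v :: s)) else f [::].

Definition pmf (R : realFieldType) (V : finType) (d : V -> R) : Prop :=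
  (forall v, 0 <= d v) /\ \sum_v d v = 1.

Lemma pmf_prod (R : realFieldType) (I V : finType) (w : I -> V -> R) :
  (forall i, pmf (w i)) -> pmf (fun f : {ffun I -> V} => \prod_i w i (f i)).
Proof.
move=> Hw; split=> [f|]; first by apply: prodr_ge0 => i _; case: (Hw i).
rewrite -(bigA_distr_bigA (fun i v => w i v)) /= big1 // => i _.
by case: (Hw i).
Qed.

Section Expectation.
Variables (R : realFieldType) (J : Type) (V : finType) (D : J -> V -> R).

Lemma eq_Ex js f g :
  (forall s, size s = size js -> f s = g s) -> Ex D js f = Ex D js g.
Proof.
elim: js f g => [|j js IH] f g fg /=; first exact: fg.
by apply: eq_bigr => v _; rewrite (IH _ (fun s => g (v :: s))) // => s Hs; apply: fg; rewrite /= Hs.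
Qed.

Lemma Ex_cat js1 js2 f :
  Ex D (js1 ++ js2) f = Ex D js1 (fun s1 => Ex D js2 (fun s2 => f (s1 ++ s2))).
Proof. by elim: js1 f => //= j js1 IH f; apply: eq_bigr => v _; rewrite IH. Qed.

Lemma Ex_map (J' : Type) (h : J' -> J) js f :
  Ex D [seq h j | j <- js] f = Ex (D \o h) js f.
Proof. by elim: js f => //= j js IH f; apply: eq_bigr => v _; rewrite IH. Qed.

Lemma ExD js f g : Ex D js (fun s => f s + g s) = Ex D js f + Ex D js g.
Proof.
elim: js f g => //= j js IH f g; rewrite -big_split.
by apply: eq_bigr => v _; rewrite /= IH mulrDr.
Qed.

Lemma Ex0 js : Ex D js (fun=> 0) = 0.
Proof. by elim: js => //= j js IH; rewrite big1 // => v _; rewrite IH mulr0. Qed.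

Lemma Ex_sum js (K : Type) (r : seq K) (f : K -> seq V -> R) :
  Ex D js (fun s => \sum_(k <- r) f k s) = \sum_(k <- r) Ex D js (f k).
Proof.
elim: r => [|k r IH].
  by rewrite big_nil -[RHS](Ex0 js); apply: eq_Ex => s _; rewrite big_nil.
by rewrite big_cons -IH -ExD; apply: eq_Ex => s _; rewrite big_cons.
Qed.

Hypothesis D_pmf : forall j, pmf (D j).

Lemma Ex_const js c : Ex D js (fun=> c) = c.
Proof.
elim: js => //= j js IH; under eq_bigr do rewrite IH.
by rewrite -mulr_suml (proj2 (D_pmf j)) mul1r.
Qed.

Lemma le_Ex js f g :
  (forall s, size s = size js -> f s <= g s) -> Ex D js f <= Ex D js g.
Proof.
elim: js f g => [|j js IH] f g fg /=; first exact: fg.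
apply: ler_sum => v _; apply: ler_wpM2l; first by case: (D_pmf j).
by apply: IH => s Hs; apply: fg; rewrite /= Hs.
Qed.

End Expectation.

Lemma sum_ffun_ordS (R : nmodType) (V : finType) n
    (F : {ffun 'I_n.+1 -> V} -> R) :
  \sum_f F f =
  \sum_v \sum_(f : {ffun 'I_n -> V}) F [ffun i => oapp f v (unlift ord0 i)].
Proof.
pose h (p : V * {ffun 'I_n -> V}) : {ffun 'I_n.+1 -> V} :=
  [ffun i => oapp p.2 p.1 (unlift ord0 i)].
rewrite (reindex h) ?pair_bigA //=.
exists (fun f => (f ord0, [ffun i => f (lift ord0 i)])) => [[v f]|f] _ /=.
  rewrite /h ffunE unlift_none; congr (_, _).
  by apply/ffunP => i; rewrite !ffunE liftK.
apply/ffunP => i; rewrite ffunE /=.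
by case: unliftP => [j|] -> //=; rewrite ffunE.
Qed.

(** Turns a product measure into successive draws by splitting off coordinate [ord0]. It serves
    twice: for the entries of a column and for the columns of a matrix. *)
Lemma sum_ffun_Ex (R : realFieldType) (V : finType) n (D : 'I_n -> V -> R)
    (g : seq V -> R) :
  \sum_(f : {ffun 'I_n -> V}) (\prod_i D i (f i)) * g [seq f i | i <- enum 'I_n]
  = Ex D (enum 'I_n) g.
Proof.
elim: n D g => [|n IH] D g.
  have E0 : enum 'I_0 = [::] by apply: size0nil; rewrite size_enum_ord.
  rewrite E0 /= (eq_bigr (fun=> g [::])) => [|f _]; last first.
    by rewrite big_ord0 mul1r.
  by rewrite sumr_const card_ffun card_ord expn0.
rewrite enum_ordSl /= sum_ffun_ordS; apply: eq_bigr => v _.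
rewrite Ex_map -IH mulr_sumr; apply: eq_bigr => f _.
rewrite big_ord_recl ffunE unlift_none /= mulrA -map_comp.
congr (_ * _ * g (_ :: _)).
  by apply: eq_bigr => i _; rewrite ffunE liftK.
by apply: eq_map => i /=; rewrite ffunE liftK.
Qed.

(** * Concentration of a random column on a subspace *)

Section Odlyzko.
Variables (R : realFieldType) (J : Type) (T : finType) (w : J -> T -> R).
Variables (F : fieldType) (phi : T -> F) (a : R).
Hypothesis a_ge0 : 0 <= a.
Hypothesis w_pmf : forall j, pmf (w j).
Hypothesis w_conc : forall j c, \sum_(t | phi t == c) w j t <= a.

Lemma mem_span_comb (L : vectType F) (r : J -> L) xs js :
  \sum_(z <- zip xs js) phi z.1 *: r z.2 \in <<[seq r j | j <- js]>>%VS.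
Proof.
elim: js xs => [|j js IH] [|x xs] /=; rewrite ?big_nil ?mem0v //.
by rewrite big_cons span_cons memv_add ?memvZ ?memv_line.
Qed.

(* The bound is P(sum in U) <= a ^ codim U, kept free of division since a may vanish.
   Once the other coordinates are exposed, a vector r j outside <<r js>> + U
   leaves a single admissible value for phi t. *)
Lemma odlyzko (L : vectType F) (U : {vspace L}) (r : J -> L) (js : seq J) (y : L) :
  Ex w js (fun xs => (\sum_(z <- zip xs js) phi z.1 *: r z.2 + y \in U)%:R)
    * a ^+ \dim U <= a ^+ \dim (<<[seq r j | j <- js]>> + U).
Proof.
elim: js y => [|j js IH] y /=.
  rewrite big_nil add0r span_nil add0v.
  case: (_ \in _); rewrite ?mul1r ?mul0r ?exprn_ge0 //.
rewrite span_cons -addvA; set W := (<<_>> + U)%VS in IH *.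
(* If [phi t *: r j + y] misses [W], no completion lands in [U]: subtracting the remaining
   combination, which lies in the span, would put it in [W]. *)
have step t : Ex w js (fun xs => (\sum_(z <- zip (t :: xs) (j :: js))
      phi z.1 *: r z.2 + y \in U)%:R) * a ^+ \dim U
    <= (phi t *: r j + y \in W)%:R * a ^+ \dim W.
  case Wt: (_ \in W).
    rewrite mul1r; apply: le_trans (IH (phi t *: r j + y)).
    rewrite le_eqVlt; apply/orP; left; apply/eqP; congr (_ * _).
    by apply: eq_Ex => xs _; rewrite big_cons addrCA addrA.
  rewrite mul0r (@eq_Ex _ _ _ _ _ _ (fun=> 0)) ?Ex0 ?mul0r // => xs Hxs.
  case Ut: (_ \in U) => //; suff: phi t *: r j + y \in W by rewrite Wt.
  move: Ut; rewrite big_cons /= addrAC => Ut.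
  rewrite -[_ + y](addrK (\sum_(z <- zip xs js) phi z.1 *: r z.2)) addrC.
  by apply: memv_add => //; rewrite memvN mem_span_comb.
rewrite mulr_suml; under eq_bigr do rewrite -mulrA.
have w0 t : 0 <= w j t by case: (w_pmf j).
apply: le_trans (ler_sum _ (fun t _ => ler_wpM2l (w0 t) (step t))) _.
have [rW|rW] := boolP (r j \in W).
  have -> : (<[r j]> + W = W)%VS by apply/addv_idPr; rewrite -memvE.
  apply: le_trans (_ : \sum_t w j t * a ^+ \dim W <= _); last first.
    by rewrite -mulr_suml (proj2 (w_pmf j)) mul1r.
  apply: ler_sum => t _; apply: ler_wpM2l => //.
  by case: (_ \in W); rewrite ?mul1r ?mul0r ?exprn_ge0.
have -> : (\dim (<[r j]> + W) = (\dim W).+1)%N.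
  have r0 : r j != 0 by apply: contraNneq rW => ->; rewrite mem0v.
  rewrite dimv_disjoint_sum ?dim_vline ?r0 //.
  apply/eqP; rewrite -subv0; apply/subvP => u /memv_capP[/vlineP[k ->]].
  by rewrite rpredZeq (negPf rW) orbF => /eqP ->; rewrite scale0r mem0v.
have [c Hc] : exists c, forall t, phi t *: r j + y \in W -> phi t = c.
  have [t0 Ht0|none] := pickP (fun t => phi t *: r j + y \in W); last first.
    by exists 0 => t; rewrite none.
  exists (phi t0) => t Ht; apply/eqP; rewrite -subr_eq0.
  have := memvB Ht Ht0; rewrite opprD addrACA subrr addr0 -scalerBl.
  by rewrite rpredZeq (negPf rW) orbF.
rewrite exprS; apply: le_trans (_ : (\sum_(t | phi t == c) w j t) * a ^+ \dim W <= _); last first.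
  by rewrite ler_wpM2r ?exprn_ge0.
rewrite mulr_suml [leRHS]big_mkcond; apply: ler_sum => t _ /=.
case Wt: (_ \in W); first by rewrite (Hc _ Wt) eqxx mul1r.
by rewrite mul0r mulr0; case: ifP => // _; rewrite mulr_ge0 ?exprn_ge0.
Qed.
End Odlyzko.

(** * Failure of random columns to span over a field *)

Section SpanningFailure.
Variables (R : realFieldType) (J : Type) (V : finType) (D : J -> V -> R).
Variables (F : fieldType) (L : vectType F) (psi : V -> L) (a lam : R) (Phi : nat -> R).
Hypothesis D_pmf : forall j, pmf (D j).
Hypothesis lam_ge0 : 0 <= lam.
Hypothesis D_conc : forall j (U : {vspace L}),
  (\sum_(v | psi v \in U) D j v) * a ^+ \dim U <= a ^+ \dim {:L}.
Hypothesis a_gt0 : 0 < a.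
Hypothesis Phi_ge1 : forall d, 1 <= Phi d.
(* A new column stays in U with probability at most a ^ codim U, so by Phi_step the
   expected value of Phi (codim of the current span) shrinks by lam at each column. *)
Hypothesis Phi_step : forall d, a ^+ d.+1 * Phi d.+1 + Phi d <= lam * Phi d.+1.

(** [U] is the span of the columns exposed so far. Once all are exposed, [Phi_ge1] makes the
    potential dominate the failure indicator. *)
Lemma spanning_failure (js : seq J) (U : {vspace L}) :
  Ex D js (fun s => ((U + <<[seq psi v | v <- s]>>)%VS != fullv)%:R)
    <= Phi (\dim {:L} - \dim U) * lam ^+ size js.
Proof.
have Phi0 d : 0 <= Phi d := le_trans ler01 (Phi_ge1 d).
elim: js U => [|j js IH] U /=.
  rewrite mulr1; apply: le_trans (Phi_ge1 _); by case: (_ != _).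
have [->|Un] := eqVneq U fullv.
  rewrite big1 ?mulr_ge0 ?exprn_ge0 // => v _.
  rewrite (@eq_Ex _ _ _ _ _ _ (fun=> 0)) ?Ex0 ?mulr0 // => s _.
  suff -> : (fullv + <<[seq psi v | v <- v :: s]>> = fullv :> {vspace L})%VS by rewrite eqxx.
  by apply/addv_idPl; apply: subvf.
have ltUL : (\dim U < \dim {:L})%N.
  by rewrite ltn_neqAle (dimv_leqif_eq (subvf U)) Un dimvS ?subvf.
have [d Hd] : exists d, (\dim {:L} = d.+1 + \dim U)%N.
  by exists (\dim {:L} - \dim U).-1; lia.
rewrite Hd addnK.
(* Outside [U] the codimension drops to [d]. The term in [Phi d] is charged in both cases, as the
   probability of leaving [U] is only bounded by 1. *)
have step v : Ex D js (fun s => ((U + <<[seq psi v | v <- v :: s]>>)%VS != fullv)%:R)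
    <= (if psi v \in U then Phi d.+1 else 0) * lam ^+ size js + Phi d * lam ^+ size js.
  rewrite (@eq_Ex _ _ _ _ _ _ (fun s => (((U + <[psi v]>) + <<[seq psi v | v <- s]>>)%VS != fullv)%:R)); last first.
    by move=> s _; rewrite /= span_cons addvA.
  apply: le_trans (IH _) _; case: ifP => vU.
    have -> : (U + <[psi v]> = U)%VS by apply/addv_idPl; rewrite -memvE.
    by rewrite Hd addnK lerDl mulr_ge0 ?exprn_ge0.
  suff -> : (\dim {:L} - \dim (U + <[psi v]>) = d)%N by rewrite mul0r add0r.
  have v0 : psi v != 0 by apply: contraFneq vU => ->; rewrite mem0v.
  rewrite Hd dimv_disjoint_sum ?dim_vline ?v0; first by lia.
  apply/eqP; rewrite -subv0; apply/subvP => u /memv_capP[uU /vlineP[k Hk]].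
  by move: uU; rewrite Hk rpredZeq vU orbF => /eqP ->; rewrite scale0r mem0v.
have D0 v : 0 <= D j v by case: (D_pmf j).
apply: le_trans (ler_sum _ (fun v _ => ler_wpM2l (D0 v) (step v))) _.
under eq_bigr do rewrite -mulrDl mulrA mulrDr.
rewrite -mulr_suml big_split /= -mulr_suml (proj2 (D_pmf j)) mul1r.
rewrite exprS mulrA [Phi d.+1 * lam]mulrC ler_wpM2r ?exprn_ge0 //.
apply: le_trans (Phi_step d); rewrite lerD2r.
have -> : \sum_i D j i * (if psi i \in U then Phi d.+1 else 0)
   = (\sum_(v | psi v \in U) D j v) * Phi d.+1.
  rewrite mulr_suml [RHS]big_mkcond; apply: eq_bigr => v _.
  by case: ifP => //; rewrite mulr0.
rewrite ler_wpM2r // -(ler_pM2r (exprn_gt0 (\dim U) a_gt0)) -exprD -Hd.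
exact: D_conc.
Qed.
End SpanningFailure.

(** * Subgroups of Z^n and reduction mod p *)

Section IntegerSpan.
Variable n : nat.
Implicit Types (s : seq 'rV[int]_n) (P : 'rV[int]_n -> Prop).

Definition redp p (x : 'rV[int]_n) : 'rV['F_p]_n := map_mx intr x.

Lemma redp_eq0 p x : prime p -> redp p x = 0 -> exists y, x = p%:Z *: y.
Proof.
move=> pp x0; exists (\row_j (x ord0 j %/ p)%Z); apply/rowP => j; rewrite !mxE.
rewrite mulrC divzK // (dvdz_pcharf (pchar_Fp pp)).
by move/rowP/(_ j): x0; rewrite !mxE => ->.
Qed.

(** The generated subgroup is never constructed: membership of [x] in it is stated as [x] satisfying
    every such predicate that contains the generators. *)
Record subgroup P : Prop := Subgroup {
  subgroup0 : P 0;
  subgroupB : forall x y, P x -> P y -> P (x - y) }.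

Lemma subgroupD P x y : subgroup P -> P x -> P y -> P (x + y).
Proof. by case=> P0 PB Px Py; rewrite -[y]opprK; apply: (PB) => //; rewrite -sub0r; apply: PB. Qed.

Lemma subgroupZ P (c : int) x : subgroup P -> P x -> P (c *: x).
Proof.
move=> PG Px; have nat_c (k : nat) : P (k%:Z *: x).
  elim: k => [|k IH]; first by rewrite scale0r; apply: subgroup0.
  by rewrite intS scalerDl scale1r; apply: subgroupD.
case: c => k; first exact: nat_c.
by rewrite NegzE scaleNr -sub0r; apply: subgroupB => //; apply: subgroup0.
Qed.

(** Coefficients in ['F_p] lift to natural numbers, so a combination mod [p] lifts to an integer
    one, which stays in [P]. *)
Lemma span_redp_lift p P s u : prime p -> subgroup P -> (forall x, x \in s -> P x) ->
  u \in <<[seq redp p x | x <- s]>>%VS -> exists2 z, P z & redp p z = u.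
Proof.
move=> pp PG; elim: s u => [|x s IH] u Ps /=.
  rewrite span_nil memv0 => /eqP ->; exists 0; first exact: subgroup0.
  by rewrite /redp map_mx0.
rewrite span_cons => /memv_addP[_ /vlineP[k ->] [w /IH[]]].
  by move=> y ys; apply: Ps; rewrite inE ys orbT.
move=> z Pz <- ->; exists ((k : nat)%:Z *: x + z).
  by apply: subgroupD => //; apply: subgroupZ => //; apply: Ps; rewrite inE eqxx.
rewrite /redp map_mxD map_mxZ; congr (_ *: _ + _).
exact: natr_Zp.
Qed.

(** Descent on [e]: with [e = f * p], spanning mod [p] writes [x = z + p y] with [z] in [P], so
    [f x = f z + e y] is in [P] and [f] replaces [e], down to 1. *)
Lemma subgroup_full P s (e : nat) : subgroup P -> (forall x, x \in s -> P x) ->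
  (0 < e)%N -> (forall x, P (e%:Z *: x)) ->
  (forall p, p \in primes e -> <<[seq redp p x | x <- s]>>%VS = fullv) ->
  forall x, P x.
Proof.
move=> PG Ps; have [k] := ubnP e; elim: k e => // k IH e lek e0 Pe span_e.
have [e1|e1] := leqP e 1.
  by move=> x; rewrite -[x]scale1r; have := Pe x; have -> : e = 1%N by lia.
have pp := pdiv_prime e1; have pe := pdiv_dvd e; set p := pdiv e in pp pe.
have [f Ef] := dvdnP pe; have p1 := prime_gt1 pp.
apply: (IH f); rewrite ?Ef in e0 lek *; [by nia|by nia| |] => x.
  have /(span_redp_lift pp PG Ps)[z Pz Ez] : redp p x \in <<[seq redp p x | x <- s]>>%VS.
    by rewrite span_e ?memvf // Ef mem_primes pp e0 dvdn_mull.
  have /(redp_eq0 pp)[y Ey] : redp p (x - z) = 0 by rewrite /redp map_mxB -/(redp p z) Ez subrr.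
  rewrite -[x](subrK z) Ey scalerDr scalerA -PoszM -Ef.
  by apply: subgroupD => //; apply: subgroupZ.
move=> xf; apply: span_e; rewrite Ef !mem_primes e0 in xf *.
by case/and3P: xf => -> _ xf /=; apply: dvdn_mulr.
Qed.

(** The subfamily is extracted in [X], not in [L], so that a basis mod [p] keeps its integer
    lifts. *)
Lemma free_subseq (F : fieldType) (L : vectType F) (X : eqType) (h : X -> L) (s : seq X) :
  exists t, [/\ {subset t <= s}, free [seq h x | x <- t] &
                <<[seq h x | x <- t]>>%VS = <<[seq h x | x <- s]>>%VS].
Proof.
elim: s => [|x s [t [ts tf tE]]]; first by exists [::]; rewrite nil_free.
have [xt|xt] := boolP (h x \in <<[seq h x | x <- t]>>%VS).
  exists t; split=> //; first by move=> y /ts; rewrite inE => ->; rewrite orbT.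
  by rewrite /= span_cons -tE; apply/esym/addv_idPr; rewrite -memvE.
exists (x :: t); split=> /=; last 2 first.
- by rewrite free_cons xt.
- by rewrite !span_cons tE.
by move=> y; rewrite !inE => /orP[->//|/ts ->]; rewrite orbT.
Qed.

Lemma det_entry_bound (S : 'M[int]_n) (B : nat) :
  (forall i j, `|S i j|%N <= B)%N -> (`|\det S| <= n`! * B ^ n)%N.
Proof.
move=> HB; rewrite -lez_nat abszE /determinant.
apply: le_trans (ler_norm_sum _ _ _) _.
have term_le (s : {perm 'I_n}) : `|(-1) ^+ s * \prod_i S i (s i)| <= (B ^ n)%:Z.
  rewrite normrMsign normr_prod.
  have -> : (B ^ n)%:Z = \prod_(i < n) B%:Z by rewrite prodr_const card_ord -[LHS]natz natrX natz.
  by apply: ler_prod => i _; rewrite normr_ge0 /= -abszE lez_nat.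
apply: le_trans (ler_sum _ (fun sg _ => term_le sg)) _.
by rewrite sumr_const card_Sn -mulr_natl PoszM natz.
Qed.

(** A basis mod [p] taken from the reductions gives a square matrix [S] with nonzero determinant; by
    the adjugate identity, [\det S *: x] is the integer combination of its rows with coefficients
    [x *m \adj S]. *)
Lemma span_index_bound p s (B : nat) : prime p ->
  (forall x i, x \in s -> `|x ord0 i|%N <= B)%N ->
  <<[seq redp p x | x <- s]>>%VS = fullv ->
  exists e : nat, [/\ (0 < e)%N, (e <= n`! * B ^ n)%N &
    forall P, subgroup P -> (forall x, x \in s -> P x) -> forall x, P (e%:Z *: x)].
Proof.
move=> pp Bs sE; have [t [ts tf tE]] := free_subseq (redp p) s.
have sz : size t = n.
  rewrite -(size_map (redp p)) -(eqP tf) tE sE dimvf; exact: mul1n.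
have memt (i : 'I_n) : t`_i \in s by apply/ts/mem_nth; rewrite sz.
pose S : 'M[int]_n := \matrix_i t`_i.
have redS : \det S != 0.
  apply/eqP => S0.
  have : \det (map_mx intr S : 'M['F_p]_n) == 0 by rewrite det_map_mx S0 rmorph0.
  case/det0P => v v0 vS; case/eqP: v0; apply/rowP => i; rewrite mxE.
  have szX : size [seq redp p x | x <- t] == n by rewrite size_map sz.
  have /freeP -> // : free (Tuple szX) by [].
  rewrite -[RHS]vS; apply/rowP => j; rewrite summxE !mxE.
  apply: eq_bigr => k _; rewrite (nth_map 0) ?sz // !mxE //.
exists `|\det S|%N; split.
- by rewrite absz_gt0.
- by apply: det_entry_bound => i j; rewrite mxE; apply: Bs.
move=> P PG Ps x; suff Pdet : P (\det S *: x).
  case: (leP 0 (\det S)) => [/gez0_abs -> //|/ltz0_abs ->].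
  by rewrite scaleNr -sub0r; apply: subgroupB => //; apply: subgroup0.
rewrite -mul_mx_scalar -mul_adj_mx mulmxA mulmx_sum_row.
elim/big_ind: _ => [||i _]; first exact: subgroup0; first by move=> *; apply: subgroupD.
by apply: subgroupZ => //; rewrite rowK; apply: Ps.
Qed.
End IntegerSpan.

(** [e] is the product of its prime powers, each at least 2. *)
Lemma size_primes_le e N : (0 < e)%N -> (e <= 2 ^ N)%N -> (size (primes e) <= N)%N.
Proof.
move=> e0 eN; rewrite -(@leq_exp2l 2) //; apply: leq_trans eN.
rewrite [leqRHS]prod_prime_decomp // prime_decompE big_map /=.
have: all (fun p => 2 <= p ^ logn p e)%N (primes e).
  apply/allP => p pe; have /prime_gt1 p1 : prime p by move: pe; rewrite mem_primes => /andP[].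
  by apply: (leq_trans p1); rewrite -{1}[p]expn1 leq_exp2l // logn_gt0.
elim: (primes e) => [|p r IH] /=; first by rewrite big_nil.
by case/andP=> p2 /IH; rewrite big_cons expnS; apply: leq_mul.
Qed.

(** * Generation of Z^n by random integer columns *)

Section RandomColumns.
Variables (R : realFieldType) (n m : nat) (T : finType) (ev : T -> int) (B : nat).
Variables (w : 'I_n -> 'I_m -> T -> R) (a lam : R) (Phi : nat -> R).
Hypothesis ev_bound : forall t, (`|ev t| <= B)%N.
Hypothesis w_pmf : forall i j, pmf (w i j).
Hypothesis w_conc : forall i j p c, prime p ->
  \sum_(t | (p%:Z %| ev t - c)%Z) w i j t <= a.
Hypothesis a_gt0 : 0 < a.
Hypothesis lam_ge0 : 0 <= lam.
Hypothesis Phi_ge1 : forall d, 1 <= Phi d.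
Hypothesis Phi_step : forall d, a ^+ d.+1 * Phi d.+1 + Phi d <= lam * Phi d.+1.

Definition column_pmf (j : 'I_m) (v : {ffun 'I_n -> T}) : R := \prod_i w i j (v i).
Definition column_row (v : {ffun 'I_n -> T}) : 'rV[int]_n := \row_i ev (v i).

Lemma column_pmfP j : pmf (column_pmf j).
Proof. exact: (pmf_prod (fun i => w_pmf i j)). Qed.

(** [odlyzko] for the coordinate vectors with offset 0: they span everything, so the exponent on the
    right is the full dimension. *)
Lemma column_conc p (j : 'I_m) (U : {vspace 'rV['F_p]_n}) : prime p ->
  (\sum_(v | redp p (column_row v) \in U) column_pmf j v) * a ^+ \dim U
    <= a ^+ \dim {:'rV['F_p]_n}.
Proof.
move=> pp; pose phi t : 'F_p := (ev t)%:~R.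
have conc i c : \sum_(t | phi t == c) w i j t <= a.
  apply: le_trans (w_conc i j (c : nat)%:Z pp); rewrite big_mkcond [leRHS]big_mkcond.
  apply: ler_sum => t _; have wt : 0 <= w i j t by case: (w_pmf i j).
  rewrite (dvdz_pcharf (pchar_Fp pp)) rmorphB subr_eq0 /= /phi.
  suff -> : (c : nat)%:Z%:~R = c by [].
  exact: natr_Zp.
have := odlyzko (ltW a_gt0) (fun i => w_pmf i j) conc U (delta_mx ord0) (enum 'I_n) 0.
rewrite -sum_ffun_Ex.
have -> : (<<[seq delta_mx ord0 i | i <- enum 'I_n]>> + U = {:'rV['F_p]_n})%VS.
  apply/eqP; rewrite eqEsubv subvf; apply: subv_trans _ (addvSl _ _).
  apply/subvP => u _.
  rewrite [u]row_sum_delta; apply: memv_suml => i _; apply/memvZ/memv_span.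
  by apply: map_f; rewrite mem_enum.
apply: le_trans; apply: ler_wpM2r; first by rewrite exprn_ge0 // ltW.
rewrite big_mkcond; apply: ler_sum => v _; rewrite -/(column_pmf j v).
suff -> : \sum_(z <- zip [seq v i | i <- enum 'I_n] (enum 'I_n))
    phi z.1 *: delta_mx ord0 z.2 + 0 = redp p (column_row v).
  by case: ifP => _; rewrite ?mulr1 ?mulr0.
rewrite addr0 [RHS]row_sum_delta -{2}[enum 'I_n]map_id zip_map big_map big_enum /=.
by apply: eq_bigr => i _; rewrite !mxE.
Qed.

(** Nothing on the right depends on [p]; the union bound over primes relies on this uniformity. *)
Lemma spanning_failure_mod p (js : seq 'I_m) : prime p ->
  Ex column_pmf js (fun s =>
     (<<[seq redp p (column_row v) | v <- s]>>%VS != fullv)%:R)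
    <= Phi n * lam ^+ size js.
Proof.
move=> pp.
have := spanning_failure column_pmfP lam_ge0 (fun j U => column_conc j U pp)
  a_gt0 Phi_ge1 Phi_step js 0%VS.
rewrite dimv0 subn0 dimvf /dim /= mul1n; apply: le_trans.
by rewrite le_eqVlt; apply/orP; left; apply/eqP/eq_Ex => s _; rewrite add0v.
Qed.

(* Unless the columns js1 fail to span mod 2, they have a minor e <> 0, and then the
   columns js2 only have to span modulo the at most N primes dividing e. *)
Lemma generation_failure (js1 js2 : seq 'I_m) (N : nat) (good : pred (seq {ffun 'I_n -> T})) :
  (n`! * B ^ n <= 2 ^ N)%N ->
  (forall s, (forall P, subgroup P -> (forall v, v \in s -> P (column_row v)) ->
                forall x, P x) -> good s) ->
  Ex column_pmf (js1 ++ js2) (fun s => (~~ good s)%:R)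
    <= Phi n * lam ^+ size js1 + N%:R * (Phi n * lam ^+ size js2).
Proof.
move=> HN Hgood; rewrite Ex_cat.
have Phi0 : 0 <= Phi n := le_trans ler01 (Phi_ge1 n).
have F0 : 0 <= N%:R * (Phi n * lam ^+ size js2) by rewrite !mulr_ge0 ?ler0n ?exprn_ge0.
have pr2 : prime 2 by [].
apply: le_trans (lerD (spanning_failure_mod js1 pr2) (lexx _)).
rewrite -[X in _ + X](Ex_const column_pmfP js1) -ExD.
apply: (le_Ex column_pmfP) => s1 _.
case full1: (_ == fullv); last first.
  apply: le_trans (_ : 1 <= _); last by rewrite lerDl.
  rewrite -[leRHS](Ex_const column_pmfP js2); apply: (le_Ex column_pmfP) => s2 _.
  by rewrite (ler_nat _ _ 1) leq_b1.
rewrite add0r.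
move/eqP: full1; rewrite (map_comp (redp 2) column_row) => full1.
(* [e] depends on [s1] only, so it is fixed while the independent draws [s2] are averaged. *)
have [|e [e0 /leq_trans/(_ HN) eN He]] := span_index_bound (B := B) pr2 _ full1.
  by move=> _ i /mapP[v _ ->]; rewrite mxE.
(* If [s2] spans modulo every prime divisor of [e], [subgroup_full] makes the outcome good; a bad
   outcome is therefore charged to some prime. *)
apply: le_trans (_ : Ex column_pmf js2 (fun s2 => \sum_(p <- primes e)
     (<<[seq redp p (column_row v) | v <- s2]>>%VS != fullv)%:R) <= _).
  apply: (le_Ex column_pmfP) => s2 _; case G: (good _) => /=.
    by apply: sumr_ge0 => p _; rewrite ler0n.
  have [p Hp|span_s2] := pickP (fun i : 'I_(size (primes e)) =>
      <<[seq redp (nth 0%N (primes e) i) (column_row v) | v <- s2]>>%VS != fullv).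
    rewrite (big_nth 0%N) big_mkord (bigD1 p) //= Hp lerDl.
    by apply: sumr_ge0 => i _; rewrite ler0n.
  case/negP: (negbT G); apply: Hgood => P PG Ps.
  apply: (@subgroup_full _ P [seq column_row v | v <- s2] e) => //.
  - by move=> _ /mapP[v vs ->]; apply: Ps; rewrite mem_cat vs orbT.
  - apply: He => // _ /mapP[v vs ->]; apply: Ps; by rewrite mem_cat vs.
  move=> p pe; rewrite -map_comp.
  have ip : (index p (primes e) < size (primes e))%N by rewrite index_mem.
  by have /negbFE/eqP := span_s2 (Ordinal ip); rewrite /= nth_index.
rewrite Ex_sum; apply: le_trans (_ : \sum_(p <- primes e) Phi n * lam ^+ size js2 <= _).
  rewrite big_seq [leRHS]big_seq; apply: ler_sum => p.
  by rewrite mem_primes => /andP[pp _]; apply: spanning_failure_mod.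
rewrite big_const_seq count_predT iter_addr_0 -[_ *+ size _]mulr_natl ler_wpM2r ?mulr_ge0 ?exprn_ge0 //.
by rewrite ler_nat size_primes_le.
Qed.
End RandomColumns.

(** * From random matrices to random columns *)

Section MatrixProbability.
Variables (B n m : nat) (p : 'I_n -> 'I_m -> int -> R).
Notation T := 'I_(2 * B + 1).
Variable t0 : T.

Definition box_weight (i : 'I_n) (j : 'I_m) (t : T) : R := p i j (box_val t).
(** The default column is never read when [size s = m]. *)
Definition columns_mx (s : seq {ffun 'I_n -> T}) : 'M[int]_(n, m) :=
  \matrix_(i, j) box_val (nth [ffun=> t0] s j i).

(** Exchanging the products over rows and columns makes the weight of a matrix the product of its
    column weights. *)
Lemma prob_mx_Ex (E : 'M[int]_(n, m) -> Prop) :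
  prob_mx B p E = Ex (column_pmf box_weight) (enum 'I_m)
    (fun s => if excluded_middle_informative (E (columns_mx s)) then 1 else 0).
Proof.
rewrite -sum_ffun_Ex /prob_mx.
pose h (f : {ffun 'I_m -> {ffun 'I_n -> T}}) : 'M[T]_(n, m) := \matrix_(i, j) f j i.
rewrite (reindex h) /=; last first.
  exists (fun M : 'M[T]_(n, m) => [ffun j => [ffun i => M i j]]) => [f|M] _.
    by apply/ffunP => j; apply/ffunP => i; rewrite !ffunE mxE.
  by apply/matrixP => i j; rewrite !mxE !ffunE.
apply: eq_bigr => f _.
have -> : columns_mx [seq f j | j <- enum 'I_m] = box_mx (h f).
  apply/matrixP => i j; rewrite !mxE (nth_map j) ?size_enum_ord //.
  by rewrite nth_ord_enum.
case: (excluded_middle_informative (E (box_mx (h f)))) => /= ?; last by rewrite mulr0.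
rewrite mulr1 exchange_big /=; apply: eq_bigr => j _; apply: eq_bigr => i _.
by rewrite mxE.
Qed.

(** The image of the matrix, transposed to rows, is a subgroup containing every column, hence
    everything. *)
Lemma columns_mx_surjective (s : seq {ffun 'I_n -> T}) : size s = m ->
  (forall P, subgroup P -> (forall v, v \in s -> P (column_row (@box_val B) v)) -> forall x, P x) ->
  mx_surjective (columns_mx s).
Proof.
move=> sm gen b.
pose P (x : 'rV[int]_n) := exists y, columns_mx s *m y = x^T.
have PG : subgroup P.
  split=> [|x1 x2 [y1 E1] [y2 E2]]; first by exists 0; rewrite mulmx0 trmx0.
  by exists (y1 - y2); rewrite mulmxBr E1 E2 linearB.
have [|y] := gen P PG _ b^T; last by rewrite trmxK; exists y.
move=> v vs; have vm : (index v s < m)%N by rewrite -sm index_mem.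
exists (delta_mx (Ordinal vm) 0); rewrite -colE; apply/colP => i.
by rewrite !mxE /= nth_index.
Qed.

End MatrixProbability.

Lemma nonsurjective_bound (B n m N : nat) (p : 'I_n -> 'I_m -> int -> R)
    (bound a lam : R) (Phi : nat -> R) :
  (forall i j, is_distribution bound B (p i j)) ->
  (forall i j, eps_balanced (1 - a) B (p i j)) ->
  0 < a -> 0 <= lam -> (forall d, 1 <= Phi d) ->
  (forall d, a ^+ d.+1 * Phi d.+1 + Phi d <= lam * Phi d.+1) ->
  (n`! * B ^ n <= 2 ^ N)%N ->
  Rabs (1 - prob_mx B p (@mx_surjective n m)) <=
    Phi n * lam ^+ m./2 + N%:R * (Phi n * lam ^+ (m - m./2)).
Proof.
move=> p_dist p_bal a0 lam0 Phi1 Phi_step HN.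
have t0 : 'I_(2 * B + 1) by apply: (@Ordinal _ 0); lia.
have w_pmf i j : pmf (@box_weight B n m p i j).
  by have [p0 [_ p1]] := p_dist i j; split=> [t|//]; apply/RleP/p0.
have w_conc i j q (c : int) : prime q ->
    \sum_(t | (q%:Z %| box_val t - c)%Z) @box_weight B n m p i j t <= a.
  move=> pq; apply/RleP; have := p_bal i j q c pq.
  rewrite /prob_congr -big_mkcond /= => H.
  by apply: Rle_trans H _; rewrite -[Rminus _ _]/(1 - (1 - a)) subKr; apply: Rle_refl.
pose good s : bool := if excluded_middle_informative
  (mx_surjective (@columns_mx B n m t0 s)) then true else false.
have ev_bound (t : 'I_(2 * B + 1)) : (`|box_val t|%N <= B)%N.
  by rewrite /box_val; have := ltn_ord t; lia.
(* Sequences of length other than [m] are declared good, since [columns_mx] would pad or truncate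
   them. *)
have := @generation_failure _ n m _ (@box_val B) B (@box_weight B n m p) a lam Phi ev_bound w_pmf
  w_conc a0 lam0 Phi1 Phi_step (take m./2 (enum 'I_m)) (drop m./2 (enum 'I_m)) N
  (fun s => (size s == m) ==> good s) HN.
rewrite cat_take_drop size_drop size_take size_enum_ord.
have -> : (if (m./2 < m)%N then m./2 else m) = m./2 by case: ltnP; lia.
move=> H; apply: le_trans (H _); last first.
  move=> s gen; apply/implyP => /eqP sm; rewrite /good.
  by case: excluded_middle_informative => // -[]; apply: columns_mx_surjective.
have -> : Rabs (1 - prob_mx B p (@mx_surjective n m)) =
    `|1 - prob_mx B p (@mx_surjective n m)| by exact: RabsE.
rewrite (prob_mx_Ex p t0) -[X in `|X - _|](Ex_const (column_pmfP w_pmf) (enum 'I_m)).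
(* On sequences of length [m], 1 is the sum of the failure and success indicators, so [1 - prob_mx]
   is the expectation of a nonnegative function. *)
rewrite (@eq_Ex _ _ _ _ _ (fun=> 1) (fun s => (~~ ((size s == m) ==> good s))%:R +
  (if excluded_middle_informative (mx_surjective (columns_mx m t0 s)) then 1 else 0))).
  rewrite ExD addrK ger0_norm // -[leLHS](Ex0 (column_pmf (@box_weight B n m p)) (enum 'I_m)).
  by apply: (le_Ex (column_pmfP w_pmf)) => s _; rewrite ler0n.
move=> s; rewrite size_enum_ord /good => ->; rewrite eqxx /=.
by case: excluded_middle_informative => /= _; rewrite ?add0r ?addr0.
Qed.

(* Real estimates: potential, growth and entry size *)
(* Rstruct and ssralg rebind %R to ring_scope. *)
Delimit Scope R_scope with R.
Local Close Scope ring_scope.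
Local Open Scope R_scope.

(* Phi d = exp (s (1 - a ^ d)) / lam ^ d: the exponential absorbs the product of the
   1 / (1 - a ^ j / lam), j <= d, that the recursion calls for, and stays below exp s. *)
Lemma exists_potential (a : R) : 0 < a < 1 ->
  exists lam K (Phi : nat -> R), [/\ 0 < lam < 1,
    forall d, 1 <= Phi d,
    forall d, a ^ d.+1 * Phi d.+1 + Phi d <= lam * Phi d.+1 &
    forall d, Phi d * lam ^ d <= K].
Proof.
(* [lam] is the midpoint of [a] and 1, and [s] is set so that [s * (1 - a) = / (lam - a)]. *)
move=> Ha; pose lam := (1 + a) / 2; pose s := / ((lam - a) * (1 - a)).
have Hlam : 0 < lam < 1 by rewrite /lam; lra.
have la : 0 < lam - a by rewrite /lam; lra.
have s0 : 0 < s by apply: Rinv_0_lt_compat; apply: Rmult_lt_0_compat; lra.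
have pow01 d : 0 < a ^ d <= 1.
  by elim: d => [|d IH] /=; [lra|nra].
have powl d : 0 < lam ^ d by apply: pow_lt; lra.
have powl1 d : lam ^ d <= 1 by elim: d => [|d IH] /=; [lra|have := powl d; nra].
exists lam, (exp s), (fun d => exp (s * (1 - a ^ d)) / lam ^ d); split=> // d.
- have e1 : 1 <= exp (s * (1 - a ^ d)).
    by have := exp_ineq1_le (s * (1 - a ^ d)); have := pow01 d; nra.
  apply: (Rmult_le_reg_r (lam ^ d)) => //.
  rewrite /Rdiv Rmult_assoc Rinv_l; last by have := powl d; lra.
  by have := powl1 d; nra.
- set G := exp (s * (1 - a ^ d.+1)); set G' := exp (s * (1 - a ^ d)).
  have G0 : 0 < G by apply: exp_pos.
  have G'0 : 0 < G' by apply: exp_pos.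
  have l0 := powl d; have [y0 y1] := pow01 d.
  have EG : G = G' * exp (s * (1 - a) * a ^ d).
    by rewrite /G /G' -exp_plus; congr exp; rewrite /=; ring.
  set y := a ^ d in y0 y1 EG *.
  have Hs : s * (1 - a) = / (lam - a) by rewrite /s; field; lra.
  (* exp z >= 1 + z with z = y / (lam - a), and (1 + z) (lam - a y) >= lam. *)
  have key : lam * G' <= G * (lam - a * y).
    have z0 : 0 < / (lam - a) by apply: Rinv_0_lt_compat.
    have Hz : / (lam - a) * (lam - a) = 1 by field; lra.
    have := exp_ineq1_le (s * (1 - a) * y); rewrite EG Hs => Hexp.
    have : lam <= (1 + / (lam - a) * y) * (lam - a * y).
      set z := / (lam - a) in z0 Hz *.
      have : 0 <= z * y * (a * (1 - y)) by apply: Rmult_le_pos; nra.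
      have -> : (1 + z * y) * (lam - a * y) =
        lam - a * y + y * (z * (lam - a)) + z * y * (a * (1 - y)) by ring.
      rewrite Hz; nra.
    have lay : 0 <= lam - a * y by nra.
    move=> Hz'; have Hm := Rle_trans _ _ _ Hz' (Rmult_le_compat_r _ _ _ lay Hexp).
    by rewrite Rmult_assoc [lam * _]Rmult_comm; apply: Rmult_le_compat_l Hm; lra.
  apply: (Rmult_le_reg_r (lam ^ d)) => //.
  have -> : (a ^ d.+1 * (G / lam ^ d.+1) + G' / lam ^ d) * lam ^ d = a * y * G / lam + G'.
    by rewrite /= -/y; field; lra.
  have -> : lam * (G / lam ^ d.+1) * lam ^ d = G by rewrite /=; field; lra.
  apply: (Rmult_le_reg_r lam); first lra.
  have -> : (a * y * G / lam + G') * lam = a * y * G + lam * G' by field; lra.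
  by nra.
- have -> : exp (s * (1 - a ^ d)) / lam ^ d * lam ^ d = exp (s * (1 - a ^ d)).
    by field; have := powl d; lra.
  by left; apply: exp_increasing; have := pow01 d; nra.
Qed.

(** The product is the [J]-th power of [n exp (- c n / J)], which is at most [J / c] because
    [exp u >= 1 + u]. *)
Lemma pow_mul_exp_bounded (c : R) (J : nat) : 0 < c -> (0 < J)%N ->
  exists M, 0 <= M /\ forall n, INR n ^ J * exp (- c * INR n) <= M.
Proof.
move=> c0 J0; have J0' : 0 < INR J by apply: lt_0_INR; apply/ssrnat.ltP.
exists ((INR J / c) ^ J); split.
  by apply: pow_le; left; apply: Rdiv_lt_0_compat.
move=> n; have n0 := pos_INR n.
have -> : exp (- c * INR n) = / exp (c * INR n / INR J) ^ J.
  rewrite -Rpower_pow; last exact: exp_pos.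
  rewrite /Rpower ln_exp -exp_Ropp; congr exp; field; lra.
rewrite -pow_inv -Rpow_mult_distr; apply: pow_incr; split.
  by apply: Rmult_le_pos => //; left; apply/Rinv_0_lt_compat/exp_pos.
apply: (Rmult_le_reg_r (exp (c * INR n / INR J))); first exact: exp_pos.
rewrite Rmult_assoc Rinv_l; last by have := exp_pos (c * INR n / INR J); lra.
have H := exp_ineq1_le (c * INR n / INR J).
have : INR J / c * (c * INR n / INR J) = INR n by field; lra.
have : 0 < INR J / c by apply: Rdiv_lt_0_compat.
nra.
Qed.

Lemma INR_expn (b j : nat) : INR (b ^ j)%N = INR b ^ j.
Proof. by elim: j => [|j IH] //=; rewrite expnS mult_INR IH. Qed.

(** [kap] rounds [k] up to a natural exponent; [up] adds at most 1, absorbed together with [C] by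
    [2 ^ l >= C + 1]. *)
Lemma box_radius_le (C k : R) : 0 < C ->
  exists l kap : nat, forall n, (0 < n)%N -> (box_radius C k n <= 2 ^ (n ^ kap + l))%N.
Proof.
move=> C0; have [l Hl] := INR_unbounded (C + 1); have [kap Hk] := INR_unbounded k.
exists l, kap => n n0.
have n1 : 1 <= INR n by apply: (le_INR 1); apply/ssrnat.leP.
have x0 : 0 < entry_bound C k n by apply: Rmult_lt_0_compat => //; apply: exp_pos.
have [up1 up2] := archimed (entry_bound C k n).
apply/ssrnat.leP/INR_le.
have -> : INR (box_radius C k n) = IZR (up (entry_bound C k n)).
  rewrite /box_radius INR_IZR_INZ Z2Nat.id //; apply: le_IZR; lra.
apply: (Rle_trans _ (entry_bound C k n + 1)); first lra.
have le1 : Rpower 2 (Rpower (INR n) k) <= 2 ^ (n ^ kap).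
  rewrite -Rpower_pow; last lra.
  apply: Rle_Rpower; first lra.
  rewrite INR_expn -Rpower_pow; last lra.
  by apply: Rle_Rpower => //; lra.
have le2 : C + 1 <= 2 ^ l.
  apply: Rle_trans (_ : INR l <= _); first lra.
  elim: (l) => [|i IH]; first by rewrite /=; lra.
  have : 1 <= 2 ^ i by apply: pow_R1_Rle; lra.
  by rewrite S_INR /=; lra.
have pos1 : 1 <= 2 ^ (n ^ kap) by apply: pow_R1_Rle; lra.
rewrite INR_expn pow_add /entry_bound.
have -> : INR 2 = 2 by [].
nra.
Qed.

Lemma fact_le_expn n : (n`! <= n ^ n)%N.
Proof.
suff H m : (n <= m)%N -> (n`! <= m ^ n)%N by apply: H.
elim: n m => [|n IH] m nm //; rewrite factS expnS; apply: leq_mul => //.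
by apply: IH; apply: ltnW.
Qed.

(** The factorial is at most [n ^ n], hence at most [2 ^ (n * n)]. For [j] polynomial in [n], a
    nonzero minor then has polynomially many prime divisors. *)
Lemma minor_bound (B n j : nat) :
  (B <= 2 ^ j)%N -> (n`! * B ^ n <= 2 ^ (n * (n + j)))%N.
Proof.
case: n => // n HB; rewrite mulnDr expnD; apply: leq_mul.
  apply: leq_trans (fact_le_expn _) _.
  by rewrite expnM leq_exp2r // ltnW // ltn_expl.
by rewrite mulnC expnM leq_exp2r.
Qed.

Lemma exp_le_mono x y : x <= y -> exp x <= exp y.
Proof. by case=> [/exp_increasing|->]; [left|right]. Qed.

(** * Choice of constants and asymptotics *)

Theorem theorem1 (eps delta k C : R) :
  (0 < eps)%R -> (0 < delta)%R -> (0 < k)%R -> (0 < C)%R ->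
  exists c : R, (0 < c)%R /\
  forall (m : nat -> nat)
         (p : forall n : nat, 'I_n -> 'I_(m n) -> int -> R),
    (forall n : nat, (1 <= n)%N -> ((2 + delta) * INR n <= INR (m n))%R) ->
    (forall (n : nat) (i : 'I_n) (j : 'I_(m n)), (1 <= n)%N ->
        is_distribution (entry_bound C k n) (box_radius C k n) (p n i j) /\
        eps_balanced eps (box_radius C k n) (p n i j)) ->
    exists K : R, exists N : nat,
      forall n : nat, (N <= n)%N -> (1 <= n)%N ->
        (Rabs (1 - prob_mx (box_radius C k n) (p n) (@mx_surjective n (m n)))
           <= K * exp (- c * INR n))%R.
Proof.
move=> eps0 delta0 _ C0.
(* Capping [eps] at 1/2 keeps [a] positive, and being balanced for a smaller constant is a weaker
   property. *)
pose a := 1 - Rmin eps (1 / 2).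
have Ha : 0 < a < 1.
  have min0 : 0 < Rmin eps (1 / 2) by apply: Rmin_pos; lra.
  by have min1 := Rmin_r eps (1 / 2); split; rewrite /a; lra.
have [lam [K [Phi [Hlam Phi1 Phi_step PhiK]]]] := exists_potential Ha.
pose mu := - ln lam.
have mu0 : 0 < mu by rewrite /mu; have := ln_increasing _ _ (proj1 Hlam) (proj2 Hlam); rewrite ln_1; lra.
have lamE j : lam ^ j = exp (- mu * INR j).
  rewrite -Rpower_pow; last lra.
  by rewrite /Rpower; congr exp; rewrite /mu; ring.
(* Each half exceeds [n] columns by [delta n / 2] up to rounding, worth [exp (- 2 c n)]: one factor
   [exp (- c n)] absorbs the polynomial number of primes, the other is the final rate. *)
pose c := mu * delta / 4.
have c0 : 0 < c by rewrite /c; have := Rmult_lt_0_compat _ _ mu0 delta0; lra.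
have [l [kap HB]] := box_radius_le k C0.
have [M [M0 HM]] := @pow_mul_exp_bounded c kap.+2 c0 isT.
exists c; split=> // m p Hm Hp.
(* The factor [INR (3 + l) * M] covers the number of primes, and [K * exp (mu / 2)] the potential
   and the rounding of [m n / 2]. *)
exists (INR (3 + l) * M * (K * exp (mu / 2))), 0%N => n _ n1.
have HN := minor_bound n (HB n n1); set N := (n * _)%N in HN.
have HN1 : (1 + N <= (3 + l) * n ^ kap.+2)%N.
  have le_pow i : (i <= kap.+2)%N -> (n ^ i <= n ^ kap.+2)%N by apply: leq_pexp2l.
  have H0 : (1 <= n ^ kap.+2)%N by rewrite -(expn0 n) le_pow.
  have H2 : (n * n <= n ^ kap.+2)%N by rewrite mulnn le_pow.
  have Hk : (n * n ^ kap <= n ^ kap.+2)%N by rewrite -expnS le_pow.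
  have Hl : (n * l <= l * n ^ kap.+2)%N.
    by rewrite mulnC leq_mul2l -{1}(expn1 n) le_pow ?orbT.
  by rewrite /N !mulnDr mulnDl; move: (n ^ _.+2)%N H0 H2 Hk Hl => X; lia.
have bound : Rabs (1 - prob_mx (box_radius C k n) (p n) (@mx_surjective n (m n)))
    <= Phi n * lam ^ (m n)./2 + INR N * (Phi n * lam ^ (m n - (m n)./2)).
  rewrite !RpowE INRE; apply/RleP.
  apply: (nonsurjective_bound (bound := entry_bound C k n) (a := a)) => //.
  - by move=> i j; case: (Hp n i j n1).
  - move=> i j q r pq; have [_ /(_ q r pq) H] := Hp n i j n1.
    have -> : (1 - a)%R = Rmin eps (1 / 2) by rewrite /a; ring.
    by have := Rmin_l eps (1 / 2); lra.
  - by apply/RltP; case: Ha.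
  - by apply/RleP/Rlt_le; case: Hlam.
  - by move=> d; apply/RleP.
  - by move=> d; apply/RleP; rewrite -RpowE.
have n1R : 1 <= INR n by apply: (le_INR 1); apply/ssrnat.leP.
have half_m : INR (m n) <= 2 * INR (m n)./2 + 1.
  rewrite -[in X in X <= _](odd_double_half (m n)) plus_INR -muln2 mult_INR.
  have -> : INR 2 = 2 by [].
  by case: (odd (m n)); rewrite /=; lra.
have Hmn := Hm n n1.
have lam_le : lam ^ (m n - (m n)./2) <= lam ^ (m n)./2.
  have : INR (m n)./2 <= INR (m n - (m n)./2) by apply: le_INR; lia.
  by rewrite !lamE => ?; apply: exp_le_mono; nra.
have lam0 j : 0 < lam ^ j by apply: pow_lt; lra.
have K0 : 0 <= K by apply: Rle_trans (PhiK 0%N); have := Phi1 0%N; rewrite /=; lra.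
have Phi_lam : Phi n * lam ^ (m n)./2 <= K * exp (mu / 2) * exp (- c * INR n) * exp (- c * INR n).
  (* [PhiK] spends [n] columns on [Phi n]; the surplus gives the decay, and [exp (mu / 2)] pays for
     an odd [m n]. *)
  have -> : Phi n * lam ^ (m n)./2 = Phi n * lam ^ n * exp (- mu * (INR (m n)./2 - INR n)).
    by rewrite !lamE Rmult_assoc -exp_plus; congr (_ * exp _); ring.
  rewrite [X in _ <= X](_ : _ = K * exp (mu / 2 + - c * INR n + - c * INR n)); last first.
    by rewrite !exp_plus; ring.
  apply: Rmult_le_compat => //.
  + by apply: Rmult_le_pos; [have := Phi1 n; lra|left].
  + by left; apply: exp_pos.
  + apply: exp_le_mono.
    have : INR n + delta * INR n / 2 - / 2 <= INR (m n)./2 by lra.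
    by rewrite /c; nra.
apply: Rle_trans bound _.
apply: Rle_trans (_ : INR (1 + N) * (Phi n * lam ^ (m n)./2) <= _).
  rewrite plus_INR Rmult_plus_distr_r Rmult_1_l; apply: Rplus_le_compat_l.
  apply: Rmult_le_compat_l; first exact: pos_INR.
  by apply: Rmult_le_compat_l lam_le; have := Phi1 n; lra.
have E0 := exp_pos (- c * INR n).
have KE : 0 <= K * exp (mu / 2) by apply: Rmult_le_pos => //; left; apply: exp_pos.
have HN2 : INR (1 + N) <= INR (3 + l) * INR n ^ kap.+2.
  by rewrite -INR_expn -mult_INR; apply/le_INR/ssrnat.leP.
apply: Rle_trans (Rmult_le_compat _ _ _ _ _ _ HN2 Phi_lam) _.
- exact: pos_INR.
- by apply: Rmult_le_pos; [have := Phi1 n; lra|left].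
have -> : INR (3 + l) * INR n ^ kap.+2 * (K * exp (mu / 2) * exp (- c * INR n) * exp (- c * INR n))
  = INR (3 + l) * (INR n ^ kap.+2 * exp (- c * INR n)) * (K * exp (mu / 2)) * exp (- c * INR n).
  by ring.
apply: Rmult_le_compat_r; first by left.
apply: Rmult_le_compat_r => //; apply: Rmult_le_compat_l => //; exact: pos_INR.
Qed.
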